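(* Let $R$ be a finite symmetric Frobenius $\mathbb{Z}/m$-algebra and let $U\subset R^\times$ be a subgroup such that $-1\in U$. Suppose that $R$ has the $n$-sum property with respect to $U$ for some positive integer $n$. Let $\Gamma(R,S)$ be a $U$-unitary Cayley graph, with $0\notin S$. Then $\Gamma(R,S)$ has no perfect state transfer (PST).
   Context: Rings are finite, unital, with $0\neq 1$, not necessarily commutative. A finite $\mathbb{Z}/m$-algebra $R$ is a symmetric Frobenius algebra if it is equipped with a $\mathbb{Z}/m$-linear functional $\psi\colon R\to\mathbb{Z}/m$ such that $\psi(ab)=\psi(ba)$ for all $a,b\in R$ and $\ker\psi$ contains no nonzero left ideal of $R$. $R$ has the $n$-sum property with respect to a subset $T\subset R$ if every element of $R$ is a sum of exactly $n$ elements of $T$. The Cayley graph $\Gamma(R,S)$, $S\subset R$, has vertex set $R$ with $a,b$ adjacent if $a-b\in S$; it is $U$-unitary if $S$ is stable under left and right multiplication by $U$. For an undirected simple graph $G$ with adjacency matrix $A_G$, put $F(t)=\exp(\mathrm{i}A_Gt)$; PST occurs in $G$ if there exist distinct vertices $a,b$ and a real number $t>0$ with $|F(t)_{ab}|=1$. *)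

(* Defs.v *)
From HB Require Import structures.
From mathcomp Require Import all_boot all_order all_fingroup all_algebra.
From mathcomp Require Import complex.
From mathcomp Require Import all_classical all_reals all_analysis.
Set Implicit Arguments.
Unset Strict Implicit.
Unset Printing Implicit Defensive.
Import Order.TTheory GRing.Theory Num.Theory.
Import numFieldNormedType.Exports.
Local Open Scope ring_scope.

Definition left_ideal (R : finNzRingType) (I : {set R}) : Prop :=
  zmod_closed I /\ (forall a x : R, x \in I -> a * x \in I).

Definition symmetric_frobenius (m : nat) (R : finAlgType 'Z_m)
    (psi : {scalar R}) : Prop :=
  (forall a b : R, psi (a * b) = psi (b * a)) /\
  (forall I : {set R},
    left_ideal I -> (forall x, x \in I -> psi x = 0) -> I = [set 0]%SET).

(* The summands need not be distinct. *)
Definition n_sum_property (R : finNzRingType) (n : nat) (T : {set R}) : Prop :=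
  forall x : R, exists2 f : 'I_n -> R,
    forall i, f i \in T & x = \sum_(i < n) f i.

(* A set of units, viewed in the ring: U is a subgroup of {unit R}, while S
   and the n-sum property live in R. *)
Definition units_in (R : finUnitRingType) (U : {set {unit R}}) : {set R} :=
  [set val u | u in U]%SET.

Definition cayley (R : finNzRingType) (S : {set R}) : rel R :=
  fun a b => a - b \in S.

Definition U_unitary (R : finNzRingType) (U S : {set R}) : Prop :=
  forall u s : R, u \in U -> s \in S -> u * s \in S /\ s * u \in S.

Lemma cayley_irrefl (R : finNzRingType) (S : {set R}) :
  0 \notin S -> irreflexive (cayley S).
Proof. by move=> S0 a; rewrite /cayley subrr; apply/negbTE. Qed.

Lemma cayley_sym (R : finNzRingType) (U S : {set R}) :
  -1 \in U -> U_unitary U S -> symmetric (cayley S).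
Proof.
move=> U1 US a b; rewrite /cayley; apply/idP/idP => /(US _ _ U1)[+ _];
by rewrite mulN1r opprB.
Qed.

(* The usual power series; the limit is taken in the normed topology of
   'M[C]_n. *)
Definition expmx (C : numFieldType) (n : nat) (M : 'M[C]_n) : 'M[C]_n :=
  limn (series (fun k : nat => (k`!%:R)^-1 *: M ^+ k)).

(* Matrices indexed by V are encoded on 'I_#|V| through enum_val/enum_rank. *)
Definition adjacency_mx (C : numFieldType) (V : finType) (e : rel V) :
    'M[C]_#|V| :=
  \matrix_(i, j) (e (enum_val i) (enum_val j))%:R.

Definition transfer_mx (K : realType) (V : finType) (e : rel V) (t : K) :
    'M[K[i]]_#|V| :=
  expmx ((0 +i* t)%C *: adjacency_mx K[i] e).

(* Meant for a symmetric irreflexive e; see cayley_sym and cayley_irrefl. *)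
Definition PST (K : realType) (V : finType) (e : rel V) : Prop :=
  exists (a b : V) (t : K),
    [/\ a != b, 0 < t &
        `|transfer_mx e t (enum_rank a) (enum_rank b)| = 1].

(* Main.v *)
Require Import Defs.
From HB Require Import structures.
From mathcomp Require Import all_boot all_order all_fingroup all_algebra.
From mathcomp Require Import complex.
From mathcomp Require Import all_classical all_reals all_analysis.
From mathcomp Require Import sesquilinear spectral.
Set Implicit Arguments.
Unset Strict Implicit.
Unset Printing Implicit Defensive.
Import Order.TTheory GRing.Theory Num.Theory.
Import numFieldNormedType.Exports.
Local Open Scope ring_scope.
Local Open Scope sesquilinear_scope.
Local Open Scope classical_set_scope.

(** Write F(t) = exp(i t A) for the transfer matrix of a graph with adjacency
    matrix A.  Two facts about F(t) are used.

    - F(t) is unitary: A is real symmetric, so A = P^* D P with P unitary and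
      D real diagonal, hence F(t) = P^* exp(i t D) P
      ([expmx_real_symmetric]).
    - F(t) is invariant under every automorphism s of the graph:
      F(t)_{s a, s b} = F(t)_{a b} ([expmx_perm]).

    Suppose |F(t)_{a b}| = 1.  The squared moduli in row a sum to 1, so b is
    the only vertex at which that row has an entry of modulus 1.  If s fixes a,
    the entry at s b has the same modulus as the entry at b, whence s b = b:
    every automorphism fixing a also fixes b ([PST_automorphism_fix]).

    In the Cayley graph, x |-> u (x - a) + a is such an automorphism for each u
    in U.  So d = b - a satisfies u d = d for all u in U.  Writing an arbitrary
    x as a sum of n elements of U gives x d = n d, the same value for every x;
    comparing x = 0 with x = 1 yields d = 0 ([n_sum_annihilator]), so a = b. *)

Lemma cvg_mx_entries (C : numFieldType) (m n : nat) (u : nat -> 'M[C]_(m, n))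
    (M : 'M[C]_(m, n)) :
  (forall i j, (fun k => u k i j) @ \oo --> M i j) -> u @ \oo --> M.
Proof.
move=> uM A [P MP PA]; rewrite /= /nbhs /=.
have : \forall k \near \oo, forall ij : 'I_m * 'I_n, P ij.1 ij.2 (u k ij.1 ij.2).
  by apply: filter_forall => -[i j] /=; apply: uM; apply: MP.
by apply: filterS => k Pk; apply: PA => i j; have := Pk (i, j).
Qed.

Lemma cvg_real_complex (K : realType) (w : nat -> K) (c : K) :
  w @ \oo --> c ->
  (fun k => (w k)%:C%C) @ \oo --> (c%:C%C : (K[i] : numFieldType)).
Proof.
move=> /cvgrPdist_lt wc; pose C : numFieldType := K[i].
apply/(@cvgrPdist_lt C C) => -[e e'].
rewrite ltcE /= => /andP[/eqP-> e0].
near=> k; rewrite -rmorphB /= normc_def /= expr0n /= addr0 sqrtr_sqr.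
by rewrite ltcR; near: k; exact: wc.
Unshelve. all: by end_near.
Qed.

(** Real and imaginary parts are the way in to the complex exponential: the
    convergence of the real series of cos and sin is then enough. *)
Lemma cvg_complex (K : realType) (u v : nat -> K) (a b : K) :
  u @ \oo --> a -> v @ \oo --> b ->
  (fun k => (u k +i* v k)%C) @ \oo --> ((a +i* b)%C : (K[i] : numFieldType)).
Proof.
move=> /cvg_real_complex ua /cvg_real_complex vb.
pose C : numFieldType := K[i].
rewrite (_ : (fun k => _) =
    fun k => (u k)%:C%C + 'i%C * (v k)%:C%C :> C); last first.
  by apply/funext => k; rewrite [LHS]complexE.
rewrite [(a +i* b)%C]complexE.
have ib : (fun k => 'i%C * (v k)%:C%C) @ \oo --> ('i%C * b%:C%C : C).
  by apply: (@cvgM C) vb; exact: cvg_cst.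
exact: (@cvgD C C _ _ _ _ _ _ _ ua ib).
Qed.

Definition cis (K : realType) (x : K) : K[i] := (cos x +i* sin x)%C.

(** Euler's formula, termwise: the k-th term of the exponential series at i x
    has the k-th coefficients of cos and sin as real and imaginary parts. *)
Lemma cvg_cis (K : realType) (x : K) :
  series (fun k => (k`!%:R)^-1 * (0 +i* x)%C ^+ k) @ \oo -->
    (cis x : (K[i] : numFieldType)).
Proof.
have termE k :
    (k`!%:R)^-1 * (0 +i* x)%C ^+ k = (cos_coeff x k +i* sin_coeff x k)%C.
  rewrite /cos_coeff /sin_coeff.
  have -> : (0 +i* x)%C = 'i%C * x%:C%C :> K[i] by simpc.
  rewrite exprMn -rmorphXn /=.
  have -> : 'i%C ^+ k = ((~~ odd k)%:R * (-1) ^+ k./2 +i*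
      ((odd k)%:R * (-1) ^+ k.-1./2))%C :> K[i].
    rewrite -[in LHS](odd_double_half k) exprD -mul2n exprM sqr_i.
    case: (boolP (odd k)) => ok; rewrite /= ?mulr0n ?mulr1n ?mul0r ?mul1r;
      last first.
      by rewrite [RHS]complexE /= mulr0 addr0 rmorphXn rmorphN1.
    have -> : k.-1./2 = k./2.
      by rewrite -[in LHS](odd_double_half k) ok /= doubleK.
    by rewrite expr1 [RHS]complexE /= add0r rmorphXn rmorphN1.
  have -> : k`!%:R^-1 = (k`!%:R^-1)%:C%C :> K[i] by rewrite fmorphV rmorph_nat.
  by rewrite mulrC; simpc; congr (_ +i* _)%C.
rewrite (_ : series _ =
    fun k => (series (cos_coeff x) k +i* series (sin_coeff x) k)%C).
  apply: cvg_complex.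
    by rewrite unlock; exact: is_cvg_series_cos_coeff.
  by rewrite unlock; exact: is_cvg_series_sin_coeff.
apply/funext => k; rewrite /series /=.
elim: k => [|k IH]; first by rewrite !big_nil.
by rewrite !big_nat_recr //= IH termE; simpc.
Qed.

Lemma norm_cis (K : realType) (x : K) : cis x * (cis x)^* = 1.
Proof.
rewrite -[(cis x)^*]/(cos x -i* sin x)%C /cis; simpc; rewrite -!expr2 cos2Dsin2.
by rewrite mulrC addNr.
Qed.

Lemma expr_conj_diag (C : numClosedFieldType) n (P : 'M[C]_n) (d : 'rV[C]_n)
    k :
  P \is unitarymx ->
  (P^t* *m diag_mx d *m P) ^+ k = P^t* *m diag_mx (\row_j d 0 j ^+ k) *m P.
Proof.
move=> Pu; have PP : P^t* *m P = 1%:M.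
  by rewrite -invmx_unitary // mulVmx // unitarymx_unit.
elim: k => [|k IH].
  rewrite expr0 (_ : \row_j _ = const_mx 1); last first.
    by apply/rowP => j; rewrite !mxE expr0.
  by rewrite diag_const_mx mulmx1 PP.
rewrite exprS IH -[LHS]/(_ *m _) !mulmxA mulmxtVK //.
rewrite -[_ *m diag_mx d *m _]mulmxA mulmx_diag.
by congr (_ *m diag_mx _ *m _); apply/rowP => j; rewrite !mxE exprS.
Qed.

Lemma unitarymx_conj_diag (C : numClosedFieldType) n (P : 'M[C]_n)
    (d : 'rV[C]_n) :
  P \is unitarymx -> (forall j, d 0 j * (d 0 j)^* = 1) ->
  P^t* *m diag_mx d *m P \is unitarymx.
Proof.
move=> Pu d1; rewrite mul_unitarymx // mul_unitarymx ?trmxC_unitary //.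
apply/unitarymxP; rewrite tr_diag_mx map_diag_mx mulmx_diag -diag_const_mx.
by congr diag_mx; apply/rowP => j; rewrite !mxE d1.
Qed.

(** Each entry of a partial sum is a fixed linear combination of the scalar
    partial sums at the eigenvalues, so scalar convergence suffices. *)
Lemma cvg_expmx_diag (K : realType) n (P : 'M[K[i]]_n) (x : 'I_n -> K) :
  P \is unitarymx ->
  series (fun k => (k`!%:R)^-1 *:
      (P^t* *m diag_mx (\row_j (0 +i* x j)%C) *m P) ^+ k) @ \oo -->
    P^t* *m diag_mx (\row_j cis (x j)) *m P.
Proof.
move=> Pu; pose C : numFieldType := K[i].
apply: cvg_mx_entries => i j.
rewrite (_ : (fun _ => _) = fun k => \sum_l P^t* i l *
    series (fun k => (k`!%:R)^-1 * (0 +i* x l)%C ^+ k) k * P l j).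
  rewrite mxE (eq_bigr (fun l => P^t* i l * cis (x l) * P l j)); last first.
    by move=> l _; rewrite mul_mx_diag !mxE.
  apply: (@cvg_big C) => [|l _]; first exact: add_continuous.
  apply: (@cvgM C); last exact: cvg_cst.
  by apply: (@cvgM C); [exact: cvg_cst | exact: cvg_cis].
apply/funext => k; rewrite /series /= summxE.
under [RHS]eq_bigr do rewrite mulr_sumr mulr_suml.
rewrite [RHS]exchange_big /=; apply: eq_bigr => p _.
rewrite expr_conj_diag // mxE mxE mulr_sumr; apply: eq_bigr => l _.
by rewrite mul_mx_diag !mxE [in RHS]mulrCA -[RHS]mulrA.
Qed.

(** The spectral theorem reduces the claim to a diagonal matrix, whose entries
    are real because A is Hermitian.  Convergence is part of the conclusion
    since [expmx] is defined by a limit, which says nothing about the partial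
    sums unless they converge. *)
Lemma expmx_real_symmetric (K : realType) n (A : 'M[K[i]]_n) (t : K) :
  A^T = A -> A \is a mxOver Num.real ->
  cvgn (series (fun k => (k`!%:R)^-1 *: ((0 +i* t)%C *: A) ^+ k)) /\
  expmx ((0 +i* t)%C *: A) \is unitarymx.
Proof.
move=> Asym Areal.
have Aherm : A \is hermsymmx.
  apply: realsym_hermsym => //; apply/is_hermitianmxP.
  by rewrite expr0 scale1r map_mx_id.
set P := spectralmx A; set d := spectral_diag A.
have Pu : P \is unitarymx := spectral_unitarymx A.
have AE : A = P^t* *m diag_mx d *m P.
  by rewrite -invmx_unitary //; apply/orthomx_spectralP/hermitian_normalmx.
pose x j : K := t * complex.Re (d 0 j).
have dE : diag_mx (\row_j (0 +i* x j)%C) = (0 +i* t)%C *: diag_mx d.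
  rewrite -linearZ; congr diag_mx; apply/rowP => j; rewrite !mxE /x.
  have /mxOverP/(_ 0 j)/RRe_real dj := hermitian_spectral_diag_real Aherm.
  by rewrite -[d 0 j in RHS]dj -/d; move: (complex.Re _) => r; simpc.
have -> : (0 +i* t)%C *: A = P^t* *m diag_mx (\row_j (0 +i* x j)%C) *m P.
  by rewrite dE -[X in X *m P]scalemxAr -[RHS]scalemxAl -AE.
have Fcvg := cvg_expmx_diag (x := x) Pu.
split; first by apply/cvg_ex; eexists; exact: Fcvg.
have -> : expmx _ = _ := cvg_lim (@norm_hausdorff _ _) Fcvg.
by apply: unitarymx_conj_diag => // j; rewrite mxE norm_cis.
Qed.

(** The powers of M inherit the symmetry of M, and taking an entry is
    continuous. *)
Lemma expmx_perm (C : numFieldType) n (s : 'S_n) (M : 'M[C]_n) :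
  cvgn (series (fun k => (k`!%:R)^-1 *: M ^+ k)) ->
  (forall i j, M (s i) (s j) = M i j) ->
  forall i j, expmx M (s i) (s j) = expmx M i j.
Proof.
move=> Mcvg Ms i j.
have Ms_exp k i' j' : (M ^+ k) (s i') (s j') = (M ^+ k) i' j'.
  elim: k i' j' => [|k IH] i' j'; first by rewrite expr0 !mxE (inj_eq perm_inj).
  rewrite exprS -[M * _]/(M *m _) !mxE (reindex_perm s) /=.
  by apply: eq_bigr => l _; rewrite Ms IH.
pose u := series (fun k => (k`!%:R)^-1 *: M ^+ k).
have entry i' j' : expmx M i' j' = limn (fun k => u k i' j').
  apply/esym/cvg_lim; first exact: norm_hausdorff.
  exact: (@continuous_cvg _ 'M[C]_n C _ _ _ (fun N => N i' j') _
    (@coord_continuous C _ _ i' j' _) Mcvg).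
rewrite !entry; congr (limn _); apply/funext => k.
rewrite /u /series /= !summxE; apply: eq_bigr => l _.
by rewrite !mxE Ms_exp.
Qed.

(** A row of a unitary matrix has squared moduli summing to 1, so it has room
    for only one entry of modulus 1. *)
Lemma unitarymx_norm1_eq (C : numClosedFieldType) n (F : 'M[C]_n) i j j' :
  F \is unitarymx -> `|F i j| = 1 -> `|F i j'| = 1 -> j = j'.
Proof.
move=> /unitarymxP/matrixP/(_ i i); rewrite !mxE eqxx mulr1n => Fi Fj Fj'.
apply/eqP; apply/negPn/negP => neq.
move: Fi; rewrite (bigD1 j) // (bigD1 j') /=; last by rewrite eq_sym.
rewrite !mxE -!normCK Fj Fj' expr1n -[RHS]addr0 => /addrI/eqP; apply/negP.
rewrite gt_eqF // ltr_pwDl // sumr_ge0 // => l _.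
by rewrite !mxE mul_conjC_ge0.
Qed.

(** Since s a = a, invariance gives the entry (a, s b) the same modulus 1 as
    the entry (a, b). *)
Lemma PST_automorphism_fix (K : realType) (V : finType) (e : rel V)
    (s : {perm V}) (a b : V) (t : K) :
  symmetric e -> (forall x y, e (s x) (s y) = e x y) -> s a = a ->
  `|transfer_mx e t (enum_rank a) (enum_rank b)| = 1 -> s b = b.
Proof.
move=> esym es sa Fab.
have [||cvgF Fu] := @expmx_real_symmetric K _ (adjacency_mx K[i] e) t.
- by apply/matrixP => i j; rewrite !mxE esym.
- by apply/mxOverP => i j; rewrite mxE realn.
pose f (i : 'I_#|V|) : 'I_#|V| := enum_rank (s (enum_val i)).
have f_inj : injective f by move=> i j /enum_rank_inj/perm_inj/enum_val_inj.
have fE x : perm f_inj (enum_rank x) = enum_rank (s x).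
  by rewrite permE /f enum_rankK.
apply: enum_rank_inj; apply: (unitarymx_norm1_eq Fu (i := enum_rank a)) => //.
rewrite -{1}sa -!fE expmx_perm // => i j.
by rewrite !mxE !permE /f !enum_rankK es.
Qed.

(** Every product x * d equals d *+ n, whatever x is; 0 * d and 1 * d then
    agree.  It matters that the number n of summands is the same for all x. *)
Lemma n_sum_annihilator (R : finNzRingType) (n : nat) (T : {set R}) (d : R) :
  n_sum_property n T -> (forall u, u \in T -> u * d = d) -> d = 0.
Proof.
move=> hsum Td.
have mulE x : x * d = d *+ n.
  have [f fT ->] := hsum x.
  rewrite mulr_suml (eq_bigr (fun=> d)) ?sumr_const ?card_ord // => i _.
  exact: Td.
by rewrite -[d]mul1r mulE -(mulE 0) mul0r.
Qed.

Theorem theorem4p2 (K : realType) (m : nat) (hm : (1 < m)%N)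
    (R : finUnitAlgType 'Z_m) (psi : {scalar R})
    (hpsi : symmetric_frobenius psi)
    (U : {group {unit R}}) (hU : -1 \in units_in U)
    (n : nat) (hn : (0 < n)%N) (hsum : n_sum_property n (units_in U))
    (S : {set R}) (hS : U_unitary (units_in U) S) (hS0 : 0 \notin S) :
  ~ PST K (cayley S).
Proof.
move=> [a [b [t [neq_ab _ Fab]]]].
suff : b - a = 0 by move/eqP; rewrite subr_eq0 eq_sym; apply/negP.
apply: (n_sum_annihilator hsum) => _ /imsetP[u uU ->].
(* Left multiplication by u, recentred so as to fix a. *)
pose s x := val u * (x - a) + a.
have s_inj : injective s.
  by move=> x y /addIr/(mulrI (valP u))/addIr.
have := @PST_automorphism_fix K R (cayley S) (perm s_inj) a b t
  (cayley_sym hU hS) _ _ Fab.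
rewrite !permE /s subrr mulr0 add0r => fix_b.
apply: (addIr a); rewrite subrK; apply: fix_b => // x y.
rewrite !permE /cayley /s opprD addrACA subrr addr0 -mulrBr opprB addrA subrK.
apply/idP/idP => [xy|/(hS _ _ (imset_f val uU))[]//].
have [+ _] := hS _ _ (imset_f val (groupVr uU)) xy.
by rewrite /= mulKr // (valP u).
Qed.
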